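(* Let $(A,\Delta,\varepsilon,\alpha,\delta)$ be a Hom-coPoisson algebra over a field of characteristic $0$ and let $\beta:A\to A$ be a Hom-coPoisson algebra morphism. Then $(A,\ \Delta_\beta=\Delta\circ\beta,\ \varepsilon,\ \alpha\circ\beta,\ \delta_\beta=\delta\circ\beta)$ is a Hom-coPoisson algebra.
   Context: Let $\sigma(x_1\otimes x_2\otimes x_3)=x_3\otimes x_1\otimes x_2$, and let $\tau_{ij}$ exchange the tensor factors $i$ and $j$. A Hom-coPoisson algebra $(A,\Delta,\varepsilon,\alpha,\delta)$ consists of linear maps $\Delta,\delta:A\to A\otimes A$, $\varepsilon:A\to\mathbb K$, $\alpha:A\to A$ such that: $(\alpha\otimes\Delta)\circ\Delta=(\Delta\otimes\alpha)\circ\Delta$ (Hom-coassociativity); $(\mathrm{id}\otimes\varepsilon)\circ\Delta=\alpha=(\varepsilon\otimes\mathrm{id})\circ\Delta$ (counit); $\tau_{12}\circ\Delta=\Delta$ (cocommutativity); $\tau_{12}\circ\delta=-\delta$ (skew-symmetry); $(\mathrm{Id}+\sigma+\sigma^2)\circ(\alpha\otimes\delta)\circ\delta=0$ (Hom-coJacobi); $(\Delta\otimes\alpha)\circ\delta=(\alpha\otimes\delta)\circ\Delta+\tau_{23}\circ(\delta\otimes\alpha)\circ\Delta$ (Hom-coLeibniz). By the standing convention all Hom-coalgebras are multiplicative: $\alpha^{\otimes2}\circ\Delta=\Delta\circ\alpha$ and $\alpha^{\otimes2}\circ\delta=\delta\circ\alpha$. A Hom-coPoisson algebra morphism $\beta:A\to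 A$ is a linear map with $\beta^{\otimes2}\circ\Delta=\Delta\circ\beta$, $\beta^{\otimes2}\circ\delta=\delta\circ\beta$, $\beta\circ\alpha=\alpha\circ\beta$ and $\varepsilon\circ\beta=\varepsilon$. *)

(* Defs.v *)
From HB Require Import structures.
From mathcomp Require Import all_boot all_order all_algebra.
From mathcomp Require Import boolp.

Set Implicit Arguments.
Unset Strict Implicit.
Unset Printing Implicit Defensive.

Import GRing.Theory.

Local Open Scope ring_scope.
Local Open Scope quotient_scope.

(* The tensor product over K of two (possibly infinite-dimensional) vector
   spaces.  A sequence of pairs stands for the formal sum of the corresponding
   symbols v (x) w, and [tens_rel] is the congruence on formal sums generated
   by the bilinearity relations; [tens_rel0] identifies 0 (x) w with the empty
   sum, so that (- v) (x) w is an opposite of v (x) w. *)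
Section Tensor.
Variables (K : fieldType) (V W : lmodType K).

Inductive tens_rel : seq (V * W) -> seq (V * W) -> Prop :=
| tens_rel_refl s : tens_rel s s
| tens_rel_sym s t : tens_rel s t -> tens_rel t s
| tens_rel_trans s t u : tens_rel s t -> tens_rel t u -> tens_rel s u
| tens_rel_perm s t : perm_eq s t -> tens_rel s t
| tens_rel_cat s s' t t' :
    tens_rel s s' -> tens_rel t t' -> tens_rel (s ++ t) (s' ++ t')
| tens_rel0 w : tens_rel [:: (0, w)] [::]
| tens_relDl v v' w : tens_rel [:: (v + v', w)] [:: (v, w); (v', w)]
| tens_relDr v w w' : tens_rel [:: (v, w + w')] [:: (v, w); (v, w')]
| tens_relZ a v w : tens_rel [:: (a *: v, w)] [:: (v, a *: w)].

Definition tens_eq (s t : seq (V * W)) : bool := `[< tens_rel s t >].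

Fact tens_eq_refl : reflexive tens_eq.
Proof. by move=> s; apply/asboolP; apply: tens_rel_refl. Qed.

Fact tens_eq_sym : symmetric tens_eq.
Proof. by move=> s t; apply/asboolP/asboolP; apply: tens_rel_sym. Qed.

Fact tens_eq_trans : transitive tens_eq.
Proof.
move=> t s u /asboolP st /asboolP tu; apply/asboolP.
exact: tens_rel_trans st tu.
Qed.

Canonical tens_equiv := EquivRel tens_eq tens_eq_refl tens_eq_sym tens_eq_trans.

Definition tensor := {eq_quot tens_equiv}.

HB.instance Definition _ := Choice.on tensor.

Implicit Types (x y z : tensor) (s t : seq (V * W)).

Definition tclass s : tensor := \pi_{eq_quot tens_equiv} s.
Definition trepr x : seq (V * W) := repr (x : {eq_quot tens_equiv}).

Definition tens (v : V) (w : W) : tensor := tclass [:: (v, w)].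

Definition tens_add x y : tensor := tclass (trepr x ++ trepr y).
Definition tens_scale (a : K) x : tensor :=
  tclass [seq (a *: p.1, p.2) | p <- trepr x].
Definition tens_opp x : tensor := tens_scale (- 1) x.

Lemma tclassP s t : tclass s = tclass t <-> tens_rel s t.
Proof.
split; first by move=> /(eqmodP tens_equiv) /asboolP.
by move=> st; apply/(eqmodP tens_equiv)/asboolP.
Qed.

Lemma treprK x : tclass (trepr x) = x.
Proof. exact: reprK. Qed.

Lemma tens_rel_repr s : tens_rel (trepr (tclass s)) s.
Proof. by apply/tclassP; rewrite treprK. Qed.

Lemma tens_rel_scale a s t : tens_rel s t ->
  tens_rel [seq (a *: p.1, p.2) | p <- s] [seq (a *: p.1, p.2) | p <- t].
Proof.
elim=> //= {s t}.
- by move=> s; apply: tens_rel_refl.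
- by move=> s t _; apply: tens_rel_sym.
- by move=> s t u _ st _; apply: tens_rel_trans.
- by move=> s t st; apply/tens_rel_perm/perm_map.
- by move=> s s' t t' _ ss' _ tt'; rewrite !map_cat; apply: tens_rel_cat.
- by move=> w; rewrite scaler0; apply: tens_rel0.
- by move=> v v' w; rewrite scalerDr; apply: tens_relDl.
- by move=> v w w'; apply: tens_relDr.
- by move=> b v w; rewrite scalerA mulrC -scalerA; apply: tens_relZ.
Qed.

Lemma tclass_cat s t : tclass (s ++ t) = tens_add (tclass s) (tclass t).
Proof.
by apply/tclassP; apply: tens_rel_cat; apply/tens_rel_sym/tens_rel_repr.
Qed.

Lemma tclass_scale a s :
  tclass [seq (a *: p.1, p.2) | p <- s] = tens_scale a (tclass s).
Proof.
by apply/tclassP/tens_rel_scale/tens_rel_sym/tens_rel_repr.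
Qed.

Fact tens_addA : associative tens_add.
Proof.
move=> x y z; rewrite -[x]treprK -[y]treprK -[z]treprK.
by rewrite -!tclass_cat catA.
Qed.

Fact tens_addC : commutative tens_add.
Proof.
move=> x y; rewrite -[x]treprK -[y]treprK -!tclass_cat.
by apply/tclassP/tens_rel_perm; rewrite perm_catC.
Qed.

Fact tens_add0 : left_id (tclass [::]) tens_add.
Proof. by move=> x; rewrite -[x]treprK -tclass_cat. Qed.

Fact tens_scaleDl x : {morph tens_scale^~ x : a b / a + b >-> tens_add a b}.
Proof.
move=> a b; rewrite -[x]treprK -!tclass_scale.
elim: (trepr x) => [|[v w] s IHs]; first by rewrite tens_add0.
rewrite /= -[_ :: map _ _]cat1s tclass_cat IHs.
rewrite -[(a *: v, w) :: _]cat1s -[(b *: v, w) :: _]cat1s.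
rewrite !(tclass_cat [:: _] (map _ _)) scalerDl.
have /tclassP -> := tens_relDl (a *: v) (b *: v) w.
rewrite -[[:: _; _]]cat1s tclass_cat -!tens_addA; congr tens_add.
by rewrite !tens_addA; congr tens_add; rewrite tens_addC.
Qed.

Fact tens_scale0 x : tens_scale 0 x = tclass [::].
Proof.
rewrite -[x]treprK -tclass_scale; elim: (trepr x) => [|[v w] s IHs] //.
rewrite /= -cat1s tclass_cat IHs scale0r.
by have /tclassP -> := tens_rel0 w; rewrite tens_add0.
Qed.

Fact tens_scale1 : left_id 1 tens_scale.
Proof.
move=> x; rewrite -[x]treprK -tclass_scale; congr tclass.
by rewrite -[RHS]map_id; apply: eq_map => -[v w]; rewrite scale1r.
Qed.

Fact tens_addN : left_inverse (tclass [::]) tens_opp tens_add.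
Proof.
by move=> x; rewrite -{2}[x]tens_scale1 -tens_scaleDl addNr tens_scale0.
Qed.

HB.instance Definition _ :=
  GRing.isZmodule.Build tensor tens_addA tens_addC tens_add0 tens_addN.

Fact tens_scaleA a b x :
  tens_scale a (tens_scale b x) = tens_scale (a * b) x.
Proof.
rewrite -[x]treprK -!tclass_scale -map_comp; congr tclass.
by apply: eq_map => -[v w] /=; rewrite scalerA.
Qed.

Fact tens_scaleDr : right_distributive tens_scale +%R.
Proof.
move=> a x y; rewrite -[x]treprK -[y]treprK.
by rewrite -[_ + _]tclass_cat -!tclass_scale map_cat tclass_cat.
Qed.

HB.instance Definition _ := GRing.Zmodule_isLmodule.Build K tensor
  tens_scaleA tens_scale1 tens_scaleDr tens_scaleDl.

Fact tens_bilinear : bilinear_for *:%R *:%R tens.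
Proof.
have tZ a v w : tens (a *: v) w = a *: tens v w.
  by rewrite [RHS](esym (tclass_scale _ _)).
split=> [w a v v' | v a w w']; rewrite /=.
  rewrite -tZ -[RHS]tclass_cat; apply/tclassP; exact: tens_relDl.
rewrite -tZ -[RHS]tclass_cat; apply/tclassP.
apply: tens_rel_trans (tens_relDr _ _ _) _; rewrite -cat1s -(cat1s (_, _)).
apply: tens_rel_cat; last exact: tens_rel_refl.
exact/tens_rel_sym/tens_relZ.
Qed.

HB.instance Definition _ :=
  bilinear_isBilinear.Build K V W tensor *:%R *:%R tens tens_bilinear.

Lemma tclassE s : tclass s = \sum_(p <- s) tens p.1 p.2.
Proof.
elim: s => [|[v w] s IHs]; first by rewrite big_nil.
by rewrite big_cons -cat1s -IHs; exact: tclass_cat.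
Qed.

Lemma tensor_sumP x : exists s : seq (V * W), x = \sum_(p <- s) tens p.1 p.2.
Proof. by exists (trepr x); rewrite -tclassE treprK. Qed.

Section UniversalProperty.
Variables (U : lmodType K) (b : {bilinear V -> W -> U}).

Definition tens_lift_fun (x : tensor) : U := \sum_(p <- trepr x) b p.1 p.2.

Lemma tens_lift_class s : tens_lift_fun (tclass s) = \sum_(p <- s) b p.1 p.2.
Proof.
suff lift_rel t u : tens_rel t u ->
    \sum_(p <- t) b p.1 p.2 = \sum_(p <- u) b p.1 p.2.
  exact/lift_rel/tens_rel_repr.
elim=> {s t u} //.
- by move=> s t u _ -> _ ->.
- by move=> s t; apply: perm_big.
- by move=> s s' t t' _ ss' _ tt'; rewrite !big_cat ss' tt'.
- by move=> w; rewrite big_seq1 big_nil /= linear0l.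
- by move=> v v' w; rewrite !big_cons !big_nil !addr0 /= linearDl.
- by move=> v w w'; rewrite !big_cons !big_nil !addr0 /= linearD.
- by move=> a v w; rewrite !big_seq1 /= linearZl_LR linearZr_LR.
Qed.

Fact tens_lift_linear : linear tens_lift_fun.
Proof.
move=> a x y; rewrite -[x]treprK -[y]treprK -[_ *: _]tclass_scale.
rewrite -[_ + _]tclass_cat !tens_lift_class big_cat big_map /=; congr (_ + _).
by rewrite scaler_sumr; apply: eq_bigr => p _; rewrite linearZl_LR.
Qed.

HB.instance Definition _ :=
  GRing.isLinear.Build K tensor U *:%R tens_lift_fun tens_lift_linear.

Definition tens_lift : {linear tensor -> U} := tens_lift_fun.

Lemma tens_liftE v w : tens_lift (tens v w) = b v w.
Proof. by rewrite [LHS]tens_lift_class big_seq1. Qed.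

End UniversalProperty.

Lemma tensor_ext (U : lmodType K) (f g : {linear tensor -> U}) :
  (forall v w, f (tens v w) = g (tens v w)) -> f =1 g.
Proof.
move=> fg x; have [s ->] := tensor_sumP x.
by rewrite !linear_sum; apply: eq_bigr => p _.
Qed.

End Tensor.

Notation "V ⊗ W" := (tensor V W)
  (at level 35, right associativity, format "V  ⊗  W") : type_scope.

Section TensorMap.
Variables (K : fieldType) (V V' W W' : lmodType K).
Variables (f : {linear V -> V'}) (g : {linear W -> W'}).

Definition tens_map_fun (v : V) (w : W) : V' ⊗ W' := tens (f v) (g w).

Fact tens_map_bilinear : bilinear_for *:%R *:%R tens_map_fun.
Proof.
split=> [w a v v' | v a w w']; rewrite /tens_map_fun.
  by rewrite linearP linearPl.
by rewrite linearP linearPr.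
Qed.

HB.instance Definition _ := bilinear_isBilinear.Build K V W (V' ⊗ W')%type
  *:%R *:%R tens_map_fun tens_map_bilinear.

Definition tens_map : {linear V ⊗ W -> V' ⊗ W'} := tens_lift tens_map_fun.

Lemma tens_mapE v w : tens_map (tens v w) = tens (f v) (g w).
Proof. exact: tens_liftE. Qed.

End TensorMap.

Notation "f \ox g" := (tens_map f g)
  (at level 35, right associativity, format "f  \ox  g") : ring_scope.

Section TensorIsos.
Variables (K : fieldType) (U V W : lmodType K).

Definition tens_swap_fun (v : V) (w : W) : (W ⊗ V)%type := tens w v.

Fact tens_swap_bilinear : bilinear_for *:%R *:%R tens_swap_fun.
Proof.
by split=> [w a v v' | v a w w']; rewrite /tens_swap_fun (linearPr, linearPl).
Qed.

HB.instance Definition _ := bilinear_isBilinear.Build K V W (W ⊗ V)%type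
  *:%R *:%R tens_swap_fun tens_swap_bilinear.

Definition tens_swap : {linear V ⊗ W -> W ⊗ V} := tens_lift tens_swap_fun.

Lemma tens_swapE v w : tens_swap (tens v w) = tens w v.
Proof. exact: tens_liftE. Qed.

Definition tens_assoc_fun (x : (U ⊗ V)%type) (w : W) : (U ⊗ V ⊗ W)%type :=
  (idfun \ox applyr (@tens K V W) w) x.

Fact tens_assoc_bilinear : bilinear_for *:%R *:%R tens_assoc_fun.
Proof.
split=> [w a x y | x a w w']; rewrite /tens_assoc_fun; first by rewrite linearP.
have [s ->] := tensor_sumP x.
rewrite !linear_sum /= scaler_sumr -big_split; apply: eq_bigr => p _ /=.
by rewrite !tens_mapE /= linearPr linearPr.
Qed.

HB.instance Definition _ := bilinear_isBilinear.Build K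
  (U ⊗ V)%type W (U ⊗ V ⊗ W)%type *:%R *:%R tens_assoc_fun tens_assoc_bilinear.

Definition tens_assoc : {linear (U ⊗ V) ⊗ W -> U ⊗ V ⊗ W} :=
  tens_lift tens_assoc_fun.

Lemma tens_assocE u v w :
  tens_assoc (tens (tens u v) w) = tens u (tens v w).
Proof. by rewrite [LHS]tens_liftE /= /tens_assoc_fun tens_mapE. Qed.

Definition tens_assocV_fun (u : U) (y : (V ⊗ W)%type) : ((U ⊗ V) ⊗ W)%type :=
  ((@tens K U V : {bilinear U -> V -> U ⊗ V}) u \ox idfun) y.

Fact tens_assocV_bilinear : bilinear_for *:%R *:%R tens_assocV_fun.
Proof.
split=> [y a u u' | u a y y']; rewrite /tens_assocV_fun; last by rewrite linearP.
have [s ->] := tensor_sumP y.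
rewrite !linear_sum /= scaler_sumr -big_split; apply: eq_bigr => p _ /=.
by rewrite !tens_mapE /= linearPl linearPl.
Qed.

HB.instance Definition _ := bilinear_isBilinear.Build K U (V ⊗ W)%type
  ((U ⊗ V) ⊗ W)%type *:%R *:%R tens_assocV_fun tens_assocV_bilinear.

Definition tens_assocV : {linear U ⊗ V ⊗ W -> (U ⊗ V) ⊗ W} :=
  tens_lift tens_assocV_fun.

Lemma tens_assocVE u v w :
  tens_assocV (tens u (tens v w)) = tens (tens u v) w.
Proof. by rewrite [LHS]tens_liftE /= /tens_assocV_fun tens_mapE. Qed.

Definition tens_unitr_fun (v : V) (a : K^o) : V := a *: v.

Fact tens_unitr_bilinear : bilinear_for *:%R *:%R tens_unitr_fun.
Proof.
split=> [a b v v' | v b a a']; rewrite /tens_unitr_fun /=.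
  by rewrite scalerDr !scalerA mulrC.
by rewrite scalerDl scalerA.
Qed.

HB.instance Definition _ := bilinear_isBilinear.Build K V K^o V
  *:%R *:%R tens_unitr_fun tens_unitr_bilinear.

Definition tens_unitr : {linear V ⊗ K^o -> V} := tens_lift tens_unitr_fun.

Lemma tens_unitrE v (a : K^o) : tens_unitr (tens v a) = a *: v.
Proof. exact: tens_liftE. Qed.

End TensorIsos.

Section TensorUnitl.
Variables (K : fieldType) (V : lmodType K).

Definition tens_unitl : {linear K^o ⊗ V -> V} :=
  tens_unitr V \o tens_swap K^o V.

Lemma tens_unitlE (a : K^o) v : tens_unitl (tens a v) = a *: v.
Proof. by rewrite /= tens_swapE tens_unitrE. Qed.

End TensorUnitl.

Arguments tens_swap {K V W}.
Arguments tens_assoc {K U V W}.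
Arguments tens_assocV {K U V W}.
Arguments tens_unitr {K V}.
Arguments tens_unitl {K V}.

(* The triple tensor product of A is the right-nested A ⊗ (A ⊗ A); a map with
   values in (A ⊗ A) ⊗ A is followed by the associator [tens_assoc]. *)
Section HomCoPoisson.
Variables (K : fieldType) (A : lmodType K).

Definition tau12 : {linear A ⊗ A -> A ⊗ A} := tens_swap.

Definition tau23 : {linear A ⊗ A ⊗ A -> A ⊗ A ⊗ A} := idfun \ox tens_swap.

Lemma tau23E x1 x2 x3 :
  tau23 (tens x1 (tens x2 x3)) = tens x1 (tens x3 x2).
Proof. by rewrite [LHS]tens_mapE tens_swapE. Qed.

Definition sigma : {linear A ⊗ A ⊗ A -> A ⊗ A ⊗ A} :=
  tens_swap \o tens_assocV.

Lemma sigmaE x1 x2 x3 :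
  sigma (tens x1 (tens x2 x3)) = tens x3 (tens x1 x2).
Proof. by rewrite /= tens_assocVE tens_swapE. Qed.

Variables (Delta : {linear A -> A ⊗ A}) (eps : {linear A -> K^o}).
Variables (alpha : {linear A -> A}) (delta : {linear A -> A ⊗ A}).

Record hom_coPoisson : Prop := HomCoPoisson {
  hcp_coassoc :
    (alpha \ox Delta) \o Delta =1 tens_assoc \o (Delta \ox alpha) \o Delta;
  hcp_counitr : tens_unitr \o (idfun \ox eps) \o Delta =1 alpha;
  hcp_counitl : tens_unitl \o (eps \ox idfun) \o Delta =1 alpha;
  hcp_cocomm : tau12 \o Delta =1 Delta;
  hcp_skew : forall x, tau12 (delta x) = - delta x;
  hcp_coJacobi : forall x,
    let y := (alpha \ox delta) (delta x) in y + sigma y + sigma (sigma y) = 0;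
  hcp_coLeibniz : forall x,
    tens_assoc ((Delta \ox alpha) (delta x)) =
    (alpha \ox delta) (Delta x)
      + tau23 (tens_assoc ((delta \ox alpha) (Delta x)));
  hcp_mult_Delta : (alpha \ox alpha) \o Delta =1 Delta \o alpha;
  hcp_mult_delta : (alpha \ox alpha) \o delta =1 delta \o alpha
}.

Record hom_coPoisson_morphism (beta : {linear A -> A}) : Prop :=
  HomCoPoissonMorphism {
  hcpm_Delta : (beta \ox beta) \o Delta =1 Delta \o beta;
  hcpm_delta : (beta \ox beta) \o delta =1 delta \o beta;
  hcpm_alpha : beta \o alpha =1 alpha \o beta;
  hcpm_eps : eps \o beta =1 eps
}.

End HomCoPoisson.

(* Main.v *)
Require Import Defs.
From mathcomp Require Import all_boot all_order all_algebra.

Import GRing.Theory.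

Local Open Scope ring_scope.

(** A structure map D that commutes with beta absorbs the beta's of the
    twisted maps: (f beta (x) g beta) D beta = (f (x) g) D beta^2.  So each
    twisted axiom at x is the original one at beta^2 x (multiplicativity also
    uses that alpha and beta commute), or at beta x for the counit,
    cocommutativity and skew-symmetry axioms. *)

Lemma tens_map_comp (K : fieldType) (U V W U' V' W' : lmodType K)
    (f : {linear V -> W}) (g : {linear U -> V})
    (f' : {linear V' -> W'}) (g' : {linear U' -> V'}) :
  (f \o g) \ox (f' \o g') =1 (f \ox f') \o (g \ox g').
Proof. by apply: tensor_ext => u u' /=; rewrite !tens_mapE. Qed.

(** Functoriality of the tensor product splits off [beta \ox beta], which then passes through [D];
    used for [D] either [Delta] or [delta]. *)
Lemma tens_map_twist (K : fieldType) (A V W : lmodType K)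
    (D : {linear A -> A ⊗ A}) (beta : {linear A -> A})
    (f : {linear A -> V}) (g : {linear A -> W}) :
  (beta \ox beta) \o D =1 D \o beta ->
  forall x, ((f \o beta) \ox (g \o beta)) (D x) = (f \ox g) (D (beta x)).
Proof. by move=> betaD x; rewrite tens_map_comp /= -[D (beta x)]betaD. Qed.

Theorem proposition3p2 (K : fieldType) (charK0 : [pchar K] =i pred0)
    (A : lmodType K) (Delta : {linear A -> A ⊗ A}) (eps : {linear A -> K^o})
    (alpha : {linear A -> A}) (delta : {linear A -> A ⊗ A})
    (beta : {linear A -> A})
    (hA : hom_coPoisson Delta eps alpha delta)
    (hbeta : hom_coPoisson_morphism Delta eps alpha delta beta) :
  hom_coPoisson (Delta \o beta) eps (alpha \o beta) (delta \o beta).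
Proof.
have [coassoc counitr counitl cocomm skew coJacobi coLeibniz multD multd] := hA.
have [betaD betad beta_alpha _] := hbeta.
split.
- by move=> x; rewrite /= !tens_map_twist //; apply: coassoc.
- by move=> x; apply: counitr.
- by move=> x; apply: counitl.
- by move=> x; apply: cocomm.
- by move=> x; apply: skew.
(* [sigma], and [tau23] in the next axiom, act outside the twisted terms. *)
- by move=> x; rewrite /= tens_map_twist //; apply: coJacobi.
- by move=> x; rewrite /= !tens_map_twist //; apply: coLeibniz.
- move=> x; rewrite /= tens_map_twist // [LHS]multD /=.
  (* Refolding the composite lets [beta_alpha], stated with [\o], move the inner [alpha] past
     [beta]. *)
  by rewrite -[beta (alpha _)]/((beta \o alpha) _) beta_alpha.
- move=> x; rewrite /= tens_map_twist // [LHS]multd /=.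
  by rewrite -[beta (alpha _)]/((beta \o alpha) _) beta_alpha.
Qed.
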